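(* Let $0 < \delta < 1 < K$. Then there exist arbitrarily large finite sets $A, B$ in some vector space $V$ over $\mathbb{F}_2$ with the following two properties: (i) $\mathbb{P}(a + b \in A \mid a \in A, b \in B) \geq 1 - \delta$, where $a$ and $b$ are chosen independently and uniformly at random from $A$ and $B$ respectively; equivalently, $|\{(a,b) \in A \times B : a + b \in A\}| \geq (1-\delta)|A||B|$; (ii) there is a constant $C_{K,\delta}$ depending only on $K$ and $\delta$ such that whenever $A' \subset A$ and $B' \subset B$ satisfy $|A' + B'| \leq K|A'|$, we have $|B'| \leq C_{K,\delta} |B|^{1/2}$.
   Context: $A' + B' = \{a + b : a \in A', b \in B'\}$ denotes the sumset.
   Formalization: In (ii) the set A' is required to be nonempty: for empty A' the hypothesis |A' + B'| ≤ K|A'| holds with B' = B, which would force |B| ≤ C² and contradict B being arbitrarily large. *)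

(* Defs.v *)
From HB Require Import structures.
From mathcomp Require Import all_boot all_order all_algebra finmap.
From mathcomp Require Import reals.

Set Implicit Arguments.
Unset Strict Implicit.
Unset Printing Implicit Defensive.

Import Order.TTheory GRing.Theory Num.Theory.

Local Open Scope fset_scope.
Local Open Scope ring_scope.

Definition sumset (V : zmodType) (A B : {fset V}) : {fset V} :=
  [fset a + b | a in A, b in B].

(* Independent uniform choices from A and B are a single uniform choice from
   A `*` B. For empty S the value is 0. *)
Definition uniform_prob (R : realType) (T : choiceType) (S : {fset T})
    (E : pred T) : R :=
  #|` [fset x in S | E x]|%:R / #|` S|%:R.

(* Main.v *)
(* Take V = (F_2^k)^k, B the k^2 unit vectors, and A the words none of whose k
   rows has weight congruent to c mod D, where c is a rarest residue class. A
   random step changes a single row, so it leaves A with probability O(1/D).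

   A B' with more than (T + D)k elements has at least D directions in each of at
   least T rows. In such a row, D directions always reach the forbidden weight
   class; let the height of the row be the least number of steps needed, which
   lies in [1, D] on A. With w_j(x) the number of rows of height j, and T large,
   each x in A' has a j < D with w_j(x) < M^j and w_{j+1}(x) >= M^{j+1}: it has
   M^{j+1} neighbours in A' + B' obtained by lowering a row from height j+1 to j,
   while each of these comes from at most D M^j such points. Summing over j gives
   |A'| M <= D^2 |A' + B'|. *)

Require Import Defs.
From HB Require Import structures.
From mathcomp Require Import all_boot all_order all_algebra finmap.
From mathcomp Require Import reals.
From mathcomp Require Import zify.

Set Implicit Arguments.
Unset Strict Implicit.
Unset Printing Implicit Defensive.

Import Order.TTheory GRing.Theory Num.Theory.

Local Open Scope fset_scope.
Local Open Scope ring_scope.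

(** * Double counting for a relation with bounded degrees *)

Lemma double_count (T U : choiceType) (X : {fset T}) (Y : {fset U})
    (r : T -> U -> bool) (p q : nat) :
    (forall x, x \in X -> p <= count (r x) Y)%N ->
    (forall y, y \in Y -> count (r^~ y) X <= q)%N ->
  (#|` X| * p <= #|` Y| * q)%N.
Proof.
move=> outX inY.
have -> : (#|` X| * p = \sum_(x <- X) p)%N.
  by rewrite big_const_seq count_predT iter_addn_0 mulnC.
have -> : (#|` Y| * q = \sum_(y <- Y) q)%N.
  by rewrite big_const_seq count_predT iter_addn_0 mulnC.
apply: (@leq_trans (\sum_(x <- X) \sum_(y <- Y) r x y)%N).
  rewrite big_seq [X in (_ <= X)%N]big_seq; apply: leq_sum => x xX.
  by have := outX x xX; rewrite -sum1_count big_mkcond /=.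
rewrite exchange_big big_seq [X in (_ <= X)%N]big_seq; apply: leq_sum => y yY.
by have := inY y yY; rewrite -sum1_count big_mkcond /=.
Qed.

(** * Walks out of a good set and the height of a row *)

Section Escape.
Variables (W : zmodType) (good : pred W).

Fixpoint escapes (S : seq W) (n : nat) (w : W) : bool :=
  if n is m.+1 then has (fun s => escapes S m (w + s)) S else ~~ good w.

Lemma escapes_sum (S U : seq W) (w : W) :
  {subset U <= S} -> ~~ good (w + \sum_(u <- U) u) -> escapes S (size U) w.
Proof.
elim: U w => [|u U IHU] w sub /=; first by rewrite big_nil addr0.
rewrite big_cons addrA => bad; apply/hasP; exists u; first exact/sub/mem_head.
by apply: IHU bad => v vU; apply: sub; rewrite inE vU orbT.
Qed.

(* The value is [D.+1] when the good set cannot be left within [D] steps. *)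
Definition height (D : nat) (S : seq W) (w : W) : nat :=
  find (fun n => escapes S n w) (iota 0 D.+1).

Lemma height_leq D S w n : (n <= D)%N -> escapes S n w -> (height D S w <= n)%N.
Proof.
move=> nD esc; rewrite leqNgt; apply/negP => lt_n.
by have := before_find 0%N lt_n; rewrite nth_iota ?esc.
Qed.

Lemma height_escapes D S w :
  (height D S w <= D)%N -> escapes S (height D S w) w.
Proof.
move=> le_D; have hasW : has (fun n => escapes S n w) (iota 0 D.+1).
  by rewrite has_find size_iota.
by have := nth_find 0%N hasW; rewrite nth_iota.
Qed.

Lemma height_gt0 D S w : good w -> (0 < height D S w)%N.
Proof.
move=> gw; case: (posnP (height D S w)) => // h0.
by have := @height_escapes D S w; rewrite h0 /= gw => /(_ isT).
Qed.

(** Take the first step of a shortest escape: what remains is an escape of length [n], and a shorter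
    one from [w + s], preceded by [s], would contradict the minimality of [n.+1]. *)
Lemma height_step D S w n : (n < D)%N -> height D S w = n.+1 ->
  exists2 s, s \in S & height D S (w + s) = n.
Proof.
move=> ltnD hw; have := @height_escapes D S w; rewrite hw => /(_ ltnD) /=.
case/hasP => s sS esc; exists s => //.
have le_n : (height D S (w + s) <= n)%N by apply: height_leq => //; lia.
apply/eqP; rewrite eqn_leq le_n /= -ltnS -hw.
apply: height_leq; first lia.
by apply/hasP; exists s => //; apply: height_escapes; lia.
Qed.

End Escape.

Definition single (I : finType) (W : zmodType) (i : I) (w : W) : {ffun I -> W} :=
  [ffun i' => if i' == i then w else 0].

(** * Expansion from lowering the height of a single row *)

Section Expansion.
Variables (I : finType) (W : zmodType) (good : pred W) (D M : nat).
Variables (J : {set I}) (S : I -> seq W) (A Y : {fset {ffun I -> W}}).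
Hypothesis size_S : forall i, i \in J -> (size (S i) <= D)%N.
Hypothesis escape_S : forall i w, i \in J ->
  exists2 n, (n <= D)%N & escapes good (S i) n w.
Hypothesis good_A : forall x i, x \in A -> good (x i).
Hypothesis step_A : forall x i s, x \in A -> i \in J -> s \in S i ->
  x + single i s \in Y.

Local Notation h i x := (height good D (S i) (x i)).
Let level j (x : {ffun I -> W}) : {set I} := [set i in J | h i x == j].
Let jump j : {fset {ffun I -> W}} :=
  [fset x in A | (#|level j x| < M ^ j)%N && (M ^ j.+1 <= #|level j.+1 x|)%N].

Let h_leq i x : i \in J -> (h i x <= D)%N.
Proof.
by move=> iJ; have [n nD /(height_leq nD) /leq_trans ->] := escape_S (x i) iJ.
Qed.

(** Level 0 is empty because good rows have positive height. Without a jump, induction then keeps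
    level [j] below [M ^ j] for all [j <= D]. The [D.+1] levels exhaust [J], so [J] would have fewer
    than [D.+1 * M ^ D] rows. *)
Let jump_exists x : (0 < M)%N -> (D.+1 * M ^ D <= #|J|)%N -> x \in A ->
  exists j : 'I_D, x \in jump j.
Proof.
move=> M_gt0 bigJ xA; apply/existsP; apply: contraLR bigJ.
rewrite negb_exists => /forallP noj; rewrite -ltnNge.
have small j : (j <= D)%N -> (#|level j x| < M ^ j)%N.
  elim: j => [|j IHj] jD.
    rewrite expn0 ltnS leqn0 cards_eq0; apply/eqP/setP => i; rewrite !inE.
    by rewrite (gtn_eqF (height_gt0 _ _ (good_A _ xA))) andbF.
  have := noj (Ordinal jD); rewrite !inE xA /= IHj ?(ltnW jD) //=.
  by rewrite -ltnNge.
have cardJ : (#|J| = \sum_(j < D.+1) #|level j x|)%N.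
  rewrite -sum1_card (partition_big (fun i => inord (h i x) : 'I_D.+1) predT) //=.
  apply: eq_bigr => j _; rewrite -sum1_card; apply: eq_bigl => i.
  rewrite inE; case iJ: (i \in J) => //=.
  by rewrite -val_eqE /= inordK // ltnS h_leq.
have : (\sum_(j < D.+1) (#|level j x| + 1) <= \sum_(j < D.+1) M ^ D)%N.
  apply: leq_sum => j _; rewrite addn1.
  apply: leq_trans (small j _) _; first by rewrite -ltnS.
  by rewrite leq_pexp2l // -ltnS.
by rewrite big_split /= -cardJ !sum_nat_const card_ord; lia.
Qed.

Let lowers j (x y : {ffun I -> W}) : bool :=
  [exists i in J, [&& h i x == j.+1, h i y == j
     & has (fun s => y == x + single i s) (S i)]].

Let single_neq (x : {ffun I -> W}) i i' s :
  i' != i -> (x + single i s) i' = x i'.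
Proof. by move=> ne; rewrite !ffunE (negbTE ne) addr0. Qed.

(** Each row of height [j.+1] has a direction lowering it to [j]. Distinct rows give distinct
    neighbours, since a neighbour still has height [j.+1] in every such row but the one lowered. *)
Let out_degree j x : (j < D)%N -> x \in A ->
  (#|level j.+1 x| <= count (lowers j x) Y)%N.
Proof.
move=> jD xA.
pose dir i := nth 0 (S i)
  (find (fun s => height good D (S i) (x i + s) == j) (S i)).
have dirP i : i \in level j.+1 x ->
    dir i \in S i /\ h i (x + single i (dir i)) = j.
  rewrite inE => /andP[iJ /eqP hi].
  have [s sS hs] := height_step jD hi.
  have hasS : has (fun s => height good D (S i) (x i + s) == j) (S i).
    by apply/hasP; exists s; rewrite ?hs.
  split; first by rewrite mem_nth // -has_find.
  by rewrite !ffunE eqxx; apply/eqP; have := nth_find 0 hasS.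
rewrite cardE -size_filter.
rewrite -(size_map (fun i => x + single i (dir i))); apply: uniq_leq_size.
  rewrite map_inj_in_uniq ?enum_uniq // => i i'; rewrite !mem_enum => iL i'L eqi.
  have [_ hi] := dirP _ iL; apply/eqP; apply: contraT => ne; move: hi.
  by rewrite eqi single_neq //; move: iL; rewrite inE => /andP[_ /eqP ->]; lia.
move=> y /mapP[i]; rewrite mem_enum => iL ->.
have [dS hi] := dirP _ iL; move: iL; rewrite inE => /andP[iJ hx].
rewrite mem_filter step_A // andbT; apply/existsP; exists i.
by rewrite iJ hx hi eqxx /=; apply/hasP; exists (dir i).
Qed.

(** A predecessor of [y] is recovered from the lowered row, which has height [j] in [y], and one of
    at most [D] directions. Any one predecessor in [jump j] shows that [y] has at most [M ^ j] rows
    of height [j]: fewer than [M ^ j] before the step, and at most one more after it. *)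
Let in_degree j y : (count (lowers j ^~ y) (jump j) <= D * M ^ j)%N.
Proof.
rewrite -size_filter; set X := filter _ _.
case: (posnP (size X)) => [->//|/(mem_nth y)]; move: (nth y X 0) => x.
rewrite mem_filter => /andP[/existsP[i /and4P[iJ hx hy /hasP[s sS /eqP yE]]]].
rewrite !inE => /and3P[_ small _].
have small_y : (#|level j y| <= M ^ j)%N.
  apply: leq_trans small; apply: leq_trans (_ : #|i |: level j x| <= _)%N.
    apply/subset_leq_card/subsetP => i'; rewrite !inE => /andP[i'J].
    by case: (eqVneq i' i) => //= ne; rewrite yE single_neq // i'J.
  by rewrite cardsU1; case: (i \notin _); rewrite ?add1n ?add0n // ltnW.
apply: (@leq_trans
  (size [seq y - single i' s' | i' <- enum (level j y), s' <- S i'])); last first.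
  rewrite size_allpairs_dep sumnE big_map big_enum [(D * _)%N]mulnC /=.
  apply: (@leq_trans (\sum_(i' in level j y) D)%N).
    by apply: leq_sum => i'; rewrite inE => /andP[i'J _]; exact: size_S.
  by rewrite sum_nat_const leq_mul2r small_y orbT.
apply: uniq_leq_size; first by rewrite filter_uniq ?fset_uniq.
move=> x'; rewrite mem_filter.
case/andP=> /existsP[i' /and4P[i'J _ hy' /hasP[s' s'S /eqP y'E]]] _.
apply/allpairsPdep; exists i', s'; rewrite mem_enum inE i'J hy' y'E addrK.
by split.
Qed.

Lemma expansion : (0 < M)%N -> (D.+1 * M ^ D <= #|J|)%N ->
  (#|` A| * M <= D * D * #|` Y|)%N.
Proof.
move=> M_gt0 bigJ.
have jumpY (j : 'I_D) : (#|` jump j| * M <= D * #|` Y|)%N.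
  (* Double counting gives [M ^ j.+1] against [D * M ^ j]; cancelling [M ^ j] leaves the gain [M],
     independent of [j]. *)
  have := @double_count _ _ (jump j) Y (lowers j) (M ^ j.+1) (D * M ^ j) _ _.
  have -> : (#|` jump j| * M ^ j.+1 = #|` jump j| * M * M ^ j)%N.
    by rewrite expnS mulnA.
  rewrite mulnA leq_pmul2r ?expn_gt0 ?M_gt0 // [(#|` Y| * D)%N]mulnC; apply.
    move=> x; rewrite !inE => /and3P[xA _ /leq_trans]; apply.
    exact: out_degree.
  by move=> y _; exact: in_degree.
have coverA : (#|` A| <= \sum_(j < D) #|` jump j|)%N.
  have -> : A = \big[@fsetU _/fset0]_(j < D) jump j.
    apply/fsetP => x; apply/idP/bigfcupP.
      move=> /(jump_exists M_gt0 bigJ)[j xj].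
      by exists j => //; rewrite mem_index_enum.
    by move=> [j _]; rewrite !inE => /andP[].
  elim/big_ind2: _ => [|X m X' m' leX leX'|//]; first by rewrite cardfs0.
  by apply: leq_trans (leq_add leX leX'); rewrite cardfsU leq_subr.
apply: leq_trans (_ : (\sum_(j < D) #|` jump j|) * M <= _)%N.
  by rewrite leq_mul2r coverA orbT.
rewrite big_distrl /= -mulnA; apply: leq_trans (leq_sum _ (fun j _ => jumpY j)) _.
by rewrite sum_nat_const card_ord.
Qed.

End Expansion.

(** * Words with all rows good, and the rarity of leaving them by changing one row *)

Definition words (I : finType) (W : finZmodType) (good : {set W}) :
  {set {ffun I -> W}} := [set x : {ffun I -> W} | [forall i, x i \in good]].

Lemma wordsP (I : finType) (W : finZmodType) (good : {set W})
    (x : {ffun I -> W}) : reflect (forall i, x i \in good) (x \in words I good).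
Proof. by rewrite inE; exact: forallP. Qed.

Lemma card_words (I : finType) (W : finZmodType) (good : {set W}) :
  #|words I good| = (#|good| ^ #|I|)%N.
Proof.
rewrite -card_ffun_on; apply: eq_card => x.
by apply/wordsP/ffun_onP.
Qed.

Lemma boundary_card (I : finType) (W : finZmodType) (good : {set W}) (m : nat)
    (i : I) (w : W) :
    (#|~: good| * m <= #|good|)%N -> (0 < #|good|)%N ->
  (#|[set x in words I good | (x + single i w)%R \notin words I good]| * m
     <= #|words I good|)%N.
Proof.
move=> few good_gt0; set E := [set x in _ | _].
(* Swapping out the row [i] that [w] pushes out of [good] for an arbitrary good
   row [z], and remembering the bad row, loses no information. *)
pose f (p : {ffun I -> W} * W) : {ffun I -> W} * W :=
  ([ffun i' => if i' == i then p.2 else p.1 i'], p.1 i + w).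
have f_inj : injective f.
  move=> [x z] [x' z'] [/ffunP eqx /addIr eqi].
  have := eqx i; rewrite !ffunE eqxx => ->; congr (_, _); apply/ffunP => i'.
  by have := eqx i'; rewrite !ffunE; case: eqVneq => [->|].
have sub : f @: setX E good \subset setX (words I good) (~: good).
  apply/subsetP => _ /imsetP[[x z] /setXP[+ zG] ->] /=.
  rewrite inE => /andP[/wordsP xG xw]; rewrite inE /=; apply/andP; split.
    by apply/wordsP => i'; rewrite ffunE; case: ifP.
  rewrite inE; apply: contra xw => ok; apply/wordsP => i'; rewrite !ffunE.
  by case: eqVneq => [->|_]; rewrite ?addr0.
have := subset_leq_card sub; rewrite card_imset // !cardsX => leEA.
rewrite -(leq_pmul2r good_gt0) mulnAC.
apply: (@leq_trans (#|words I good| * #|~: good| * m)%N).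
  by rewrite leq_mul2r leEA orbT.
by rewrite -mulnA leq_mul2l few orbT.
Qed.

(** * Binary rows and their weights modulo [D] *)

Section Binary.
Variable k : nat.
Implicit Types (w : 'rV['F_2]_k) (X Y J : {set 'I_k}).

Definition supp w : {set 'I_k} := [set j | w 0 j != 0].
Definition basis_row (j : 'I_k) : 'rV['F_2]_k := delta_mx 0 j.

Lemma basis_row_inj : injective basis_row.
Proof.
move=> j j' /rowP/(_ j)/eqP; rewrite !mxE !eqxx /=.
by case: (eqVneq j j').
Qed.

Lemma supp_flip w X :
  supp (w + \sum_(j in X) basis_row j) = (supp w :\: X) :|: (X :\: supp w).
Proof.
apply/setP => j; rewrite !inE mxE summxE.
have -> : \sum_(j' in X) basis_row j' 0 j = (j \in X)%:R.
  case: (boolP (j \in X)) => jX.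
    rewrite (bigD1 j) //= big1 ?mxE ?eqxx ?addr0 // => j' /andP[_ ne].
    by rewrite mxE eq_sym (negbTE ne).
  apply: big1 => j' j'X; rewrite mxE; case: (eqVneq j j') => // eqj.
  by rewrite eqj j'X in jX.
by case: (w 0 j) => [[|[|//]] ?]; case: (j \in X).
Qed.

Definition rows_avoiding (D c : nat) : {set 'rV['F_2]_k} :=
  [set w | #|supp w| %% D != c]%N.

Lemma escapes_rows D c (s : seq 'I_k) w : (c < D)%N -> uniq s -> size s = D ->
  exists2 n, (n <= D)%N &
    escapes [in rows_avoiding D c] [seq basis_row j | j <- s] n w.
Proof.
move=> ltcD uniq_s size_s; have D_gt0 : (0 < D)%N by lia.
pose J := [set j in s]; pose m := #|supp w :\: J|.
(* [t] is the residue of [c - m], written without negative numbers: [t] ones inside [s] bring the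
   weight into class [c]. *)
pose t := ((c + (D - m %% D)) %% D)%N.
have ltmD := ltn_pmod m D_gt0; have lttD : (t < D)%N by rewrite ltn_pmod.
pose Z := (supp w :\: J) :|: [set j in take t s].
have cardZ : (#|Z| %% D = c)%N.
  rewrite cardsU (_ : _ :&: _ = set0) ?cards0 ?subn0; last first.
    apply/setP => j; rewrite !inE; apply: contraTF isT => /andP[/andP[js _]].
    by move/mem_take; rewrite (negbTE js).
  rewrite [X in (_ + X)%N]cardsE (card_uniqP _) ?take_uniq //.
  rewrite size_takel ?size_s 1?ltnW //.
  rewrite -/m /t modnDmr -modnDml addnC -addnA subnK 1?ltnW //.
  by rewrite modnDr modn_small.
(* [Z] is the target support; [U], its symmetric difference with [supp w], is the set of coordinates
   to toggle, and lies in [J] because [Z] agrees with [supp w] outside [J]. *)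
pose U := (supp w :\: Z) :|: (Z :\: supp w).
have subUJ : U \subset J.
  apply/subsetP => j; rewrite !inE negb_or negb_and negbK.
  case/orP=> [/andP[/andP[]]|/andP[]]; first by move=> /orP[//|/negbTE->].
  by move=> jw; rewrite (negbTE jw) andbF /= => /mem_take.
exists (size [seq basis_row j | j <- enum U]).
  rewrite size_map -cardE -size_s -(card_uniqP uniq_s).
  by apply: leq_trans (subset_leq_card subUJ) _; rewrite cardsE.
apply: escapes_sum.
  move=> _ /mapP[j jU ->]; apply: map_f; move: jU; rewrite mem_enum.
  by move/(subsetP subUJ); rewrite inE.
rewrite big_map big_enum /= inE negbK supp_flip.
suff -> : (supp w :\: U) :|: (U :\: supp w) = Z by rewrite cardZ.
rewrite /U; move: (supp w) (Z) => X Y; apply/setP => j; rewrite !inE.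
by case: (j \in X); case: (j \in Y).
Qed.

(** Pigeonhole: the [D] residue classes partition the [2 ^ k] rows, so they cannot all exceed the
    average. *)
Lemma rows_avoiding_dense D : (0 < D)%N -> exists2 c, (c < D)%N &
  (#|~: rows_avoiding D c| * D <= 2 ^ k)%N.
Proof.
move=> D_gt0; suff /existsP[c cP] :
    [exists c : 'I_D, #|~: rows_avoiding D c| * D <= 2 ^ k]%N by exists c.
apply: contraT; rewrite negb_exists => /forallP small.
have : (\sum_(c < D) (2 ^ k).+1 <= \sum_(c < D) #|~: rows_avoiding D c| * D)%N.
  by apply: leq_sum => c _; rewrite ltnNge small.
have <- : (\sum_(c < D) #|~: rows_avoiding D c| = 2 ^ k)%N.
  have <- : #|'rV['F_2]_k| = (2 ^ k)%N by rewrite card_mx card_Fp ?mul1n.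
  rewrite -sum1_card.
  pose residue w := Ordinal (ltn_pmod #|supp w| D_gt0).
  rewrite (partition_big residue predT) //=; apply: eq_bigr => c _.
  by rewrite -sum1_card; apply: eq_bigl => w; rewrite !inE negbK.
by rewrite -big_distrl sum_nat_const card_ord /=; lia.
Qed.

End Binary.

Lemma card_fset_set (T : finType) (X : {fset T}) : #|` X| = #|[set x | x \in X]|.
Proof.
by rewrite -card_finset; congr #|` _|; apply/fsetP => x; rewrite !inE.
Qed.

Lemma card_fsetX (T U : finType) (X : {fset T}) (Y : {fset U}) :
  #|` X `*` Y| = (#|` X| * #|` Y|)%N.
Proof.
by rewrite !card_fset_set -cardsX; apply: eq_card => -[x y]; rewrite !inE.
Qed.

(** * Unit words as steps: the two properties of the pair of sets *)

Section Directions.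
Variable k : nat.

Definition unit_word (p : 'I_k * 'I_k) : {ffun 'I_k -> 'rV['F_2]_k} :=
  single p.1 (basis_row p.2).

Lemma unit_word_inj : injective unit_word.
Proof.
move=> [i j] [i' j'] /ffunP/(_ i); rewrite !ffunE eqxx /=.
case: eqVneq => [-> /basis_row_inj -> //|_ /rowP/(_ j)/eqP].
by rewrite !mxE !eqxx.
Qed.

Definition unit_words : {fset {ffun 'I_k -> 'rV['F_2]_k}} :=
  [fset unit_word p | p in [set: 'I_k * 'I_k]].

Lemma card_unit_words : #|` unit_words| = (k * k)%N.
Proof.
rewrite card_imfset; last exact: unit_word_inj.
by rewrite -cardE cardsT card_prod card_ord.
Qed.

Definition directions (B : {fset {ffun 'I_k -> 'rV['F_2]_k}}) (i : 'I_k) :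
  {set 'I_k} := [set j | unit_word (i, j) \in B].

Lemma card_directions (B : {fset {ffun 'I_k -> 'rV['F_2]_k}}) :
  B `<=` unit_words -> (#|` B| <= \sum_i #|directions B i|)%N.
Proof.
move=> /fsubsetP subB.
have -> : (\sum_i #|directions B i| = #|[set p | unit_word p \in B]|)%N.
  under eq_bigr do rewrite -sum1_card.
  rewrite pair_big_dep -sum1_card /=.
  by apply: eq_bigl => -[i j]; rewrite !inE.
rewrite -(card_imset _ unit_word_inj) card_fset_set.
apply/subset_leq_card/subsetP => x; rewrite inE => xB.
have /imfsetP[p _ xE] := subB x xB.
by apply/imsetP; exists p; rewrite // inE -xE.
Qed.

(** With fewer than [T] rich rows, these contribute at most [k] directions each, hence [T * k] in
    all, and the [k] rows in total contribute at most [D * k] through the poor ones. *)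
Lemma many_directions (B : {fset {ffun 'I_k -> 'rV['F_2]_k}}) (D T : nat) :
    B `<=` unit_words -> ((T + D) * k < #|` B|)%N ->
  (T <= #|[set i | D <= #|directions B i|]|)%N.
Proof.
move=> subB; apply: contraLR; rewrite -!ltnNge => few.
apply: leq_trans (card_directions subB) _.
rewrite (bigID [in [set i | D <= #|directions B i|]%N]) /= mulnDl leq_add //.
  apply: (@leq_trans (\sum_(i in [set i | D <= #|directions B i|]%N) k)%N).
    by apply: leq_sum => i _; rewrite -[leqRHS]card_ord max_card.
  by rewrite sum_nat_const leq_mul2r (ltnW few) orbT.
apply: (@leq_trans (\sum_(i : 'I_k) D)%N); last first.
  by rewrite sum_nat_const card_ord mulnC.
rewrite big_mkcond; apply: leq_sum => i _; rewrite inE.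
by case: (leqP D) => // /ltnW.
Qed.

Lemma unit_words_expand (A B : {fset {ffun 'I_k -> 'rV['F_2]_k}}) (c D M : nat) :
    (c < D)%N -> (0 < M)%N ->
    (forall x, x \in A -> x \in words 'I_k (rows_avoiding k D c)) ->
    B `<=` unit_words -> ((D.+1 * M ^ D + D) * k < #|` B|)%N ->
  (#|` A| * M <= D * D * #|` sumset A B|)%N.
Proof.
move=> ltcD M_gt0 goodA subB bigB.
pose J := [set i | D <= #|directions B i|]%N.
(* Keeping exactly [D] directions per row suffices to reach every residue and respects the bound [D]
   on choices per row in [expansion]. *)
pose s i := take D (enum (directions B i)).
have size_s i : i \in J -> size (s i) = D.
  by rewrite inE => iJ; rewrite size_takel // -cardE.
apply: (@expansion _ _ [in rows_avoiding k D c] D M J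
  (fun i => [seq basis_row j | j <- s i])) => //.
- by move=> i iJ; rewrite size_map size_s.
- move=> i w iJ; apply: escapes_rows => //; last exact: size_s.
  by rewrite take_uniq // enum_uniq.
- by move=> x i /goodA/wordsP.
- move=> x i _ xA iJ /mapP[j /mem_take + ->]; rewrite mem_enum inE => jB.
  by apply/imfset2P; exists x => //; exists (unit_word (i, j)).
- exact: many_directions.
Qed.

(** For each fixed unit word, [boundary_card] bounds the exiting points of [A] by the integer part
    of [#|A| / m]; summing over the unit words bounds all exits. *)
Lemma few_exits (good : {set 'rV['F_2]_k}) (m : nat) :
    let A : {fset _} := [fset x in words 'I_k good] in
    (0 < m)%N -> (#|~: good| * m <= #|good|)%N -> (0 < #|good|)%N ->
  (#|` [fset p in A `*` unit_words | (p.1 + p.2)%R \notin A]| * m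
     <= #|` A `*` unit_words|)%N.
Proof.
move=> A m_gt0 few good_gt0; set E := [fset p in _ | _].
have cardA : #|` A| = #|words 'I_k good| by rewrite card_finset.
have : (#|` E| * 1 <= #|` unit_words| * (#|` A| %/ m))%N.
  apply: (@double_count _ _ _ _ (fun p b => p.2 == b)) => [p|b].
    rewrite !inE => /andP[/andP[_ pB] _].
    by rewrite -has_count; apply/hasP; exists p.2.
  case/imfsetP => [[i j] _ ->]; rewrite leq_divRL // cardA.
  apply: leq_trans (boundary_card i (basis_row j) few good_gt0).
  rewrite leq_mul2r cardE -size_filter -(size_map fst); apply/orP; right.
  apply: uniq_leq_size.
    rewrite map_inj_in_uniq ?filter_uniq ?fset_uniq // => -[x y] [x' y'] /=.
    by rewrite !mem_filter /= => /andP[/eqP -> _] /andP[/eqP -> _] ->.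
  move=> x /mapP[[x' y]]; rewrite mem_filter /= => /andP[/eqP ->].
  by rewrite !inE /= => /andP[/andP[xA _] xB] ->; rewrite mem_enum !inE xA.
rewrite muln1 card_fsetX => leE.
apply: (@leq_trans (#|` unit_words| * (#|` A| %/ m) * m)%N).
  by rewrite leq_mul2r leE orbT.
by rewrite -mulnA mulnC leq_mul2r leq_divM orbT.
Qed.

End Directions.

(** * Choice of parameters and conclusion *)

Theorem theorem1p1 (R : realType) (delta K : R)
    (delta_gt0 : 0 < delta) (delta_lt1 : delta < 1) (K_gt1 : 1 < K) :
  exists C : R, forall N : nat,
    exists (V : lmodType 'F_2) (A B : {fset V}),
      [/\ (N <= #|` A|)%N,
          (N <= #|` B|)%N,
          1 - delta <=
            uniform_prob R (A `*` B) (fun p : V * V => p.1 + p.2 \in A)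
        & forall A' B' : {fset V},
            A' `<=` A -> B' `<=` B -> A' != fset0 ->
            #|` sumset A' B'|%:R <= K * #|` A'|%:R ->
            #|` B'|%:R <= C * Num.sqrt #|` B|%:R].
Proof.
(* [m] exceeds [1 / delta], so an exit probability of at most [1 / m] is small enough. With
   [D = m + 1], a class of density at most [1 / D] has a complement at least [m] times as large. [M]
   exceeds [D ^ 2 * K] so that expansion beats [K], and [T] is the number of rows that [expansion]
   requires. *)
pose m := (Num.bound delta^-1).+1; pose D := m.+1.
pose M := Num.bound (D%:R * D%:R * K); pose T := (D.+1 * M ^ D)%N.
have delta_m : 1 <= delta * m%:R.
  rewrite -ler_pdivrMl // mulr1; apply: ltW.
  apply: (lt_le_trans (archi_boundP _)); first by rewrite invr_ge0 ltW.
  by rewrite ler_nat.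
have K_gt0 : 0 < K by apply: lt_trans K_gt1.
have ltM : D%:R * D%:R * K < M%:R.
  by apply: archi_boundP; rewrite !mulr_ge0 // ltW.
have M_gt0 : (0 < M)%N.
  by rewrite -(ltr_nat R); apply: le_lt_trans ltM; rewrite !mulr_ge0 // ltW.
(* Neither [T] nor [D] involves [N], which enters only through [k]. As [B] has [k * k] elements, the
   claimed bound is [(T + D) * k]. *)
exists (T + D)%:R => N; pose k := N.+1.
have [c ltcD thin] := @rows_avoiding_dense k D isT.
pose good := rows_avoiding k D c.
have cardW : (#|good| + #|~: good| = 2 ^ k)%N.
  by rewrite cardsC card_mx card_Fp // mul1n.
have few : (#|~: good| * m <= #|good|)%N.
  by move: thin; rewrite -cardW -/good mulnS; lia.
(* [good] makes up at least half of the [2 ^ N.+1] rows, so it has at least [2 ^ N] elements. *)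
have good_gt : (N < #|good|)%N.
  have lt2 : (N < 2 ^ N)%N by rewrite ltn_expl.
  have : (#|~: good| <= #|good|)%N.
    by apply: leq_trans few; rewrite leq_pmulr.
  by move: cardW; rewrite expnS; lia.
pose A : {fset _} := [fset x in words 'I_k good].
have cardA : #|` A| = (#|good| ^ k)%N.
  by rewrite card_finset card_words card_ord.
exists {ffun 'I_k -> 'rV['F_2]_k}, A, (unit_words k).
have leNA : (N <= #|` A|)%N.
  rewrite cardA; apply: leq_trans (ltnW good_gt) _.
  by rewrite -[X in (X <= _)%N]expn1 leq_pexp2l //; lia.
have leNB : (N <= #|` unit_words k|)%N by rewrite card_unit_words; nia.
split=> //.
- rewrite /uniform_prob; set P := A `*` _.
  have P_gt0 : (0 < #|` P|)%N.
    by rewrite card_fsetX cardA card_unit_words muln_gt0 expn_gt0; lia.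
  rewrite ler_pdivlMr ?ltr0n //.
  have := @few_exits k good m isT few (leq_ltn_trans (leq0n _) good_gt).
  rewrite -/A -/P; set E := [fset p in P | _ \notin _] => leE.
  have -> : [fset p in P | p.1 + p.2 \in A] = P `\` E.
    apply/fsetP => p; rewrite in_fsetD !in_fset.
    rewrite -[LHS]/((p \in P) && (p.1 + p.2 \in A)).
    rewrite -[X in ~~ X && _]/((p \in P) && (p.1 + p.2 \notin A)).
    by case: (p \in P) => //=; rewrite negbK andbT.
  rewrite cardfsDS ?fset_sub // natrB ?fsubset_leq_card ?fset_sub //.
  rewrite mulrBl mul1r lerB //.
  have leER : #|` E|%:R * m%:R <= #|` P|%:R :> R by rewrite -natrM ler_nat.
  apply: le_trans (_ : delta * (#|` E|%:R * m%:R) <= _); last first.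
    by rewrite ler_wpM2l // ltW.
  by rewrite mulrCA ler_peMr.
- move=> A' B' subA subB A'_neq0 small.
  rewrite card_unit_words natrM -expr2 sqrtr_sqr normr_nat -natrM ler_nat.
  rewrite leqNgt; apply/negP => bigB.
  have goodA' x : x \in A' -> x \in words 'I_k good.
    by move=> /(fsubsetP subA); rewrite inE.
  (* Expansion would give [M * |A'| <= D ^ 2 * |A' + B'| <= D ^ 2 * K * |A'|], which is less than
     [M * |A'|] as [A'] is nonempty. *)
  have := unit_words_expand ltcD M_gt0 goodA' subB bigB.
  apply/negP; rewrite -ltnNge -(ltr_nat R) !natrM.
  apply: le_lt_trans (_ : D%:R * D%:R * (K * #|` A'|%:R) < _).
    by rewrite ler_wpM2l // mulr_ge0.
  by rewrite mulrA [ltRHS]mulrC ltr_pM2r // ltr0n cardfs_gt0.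
Qed.
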